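(* Let $G$ be a locally-finite group, and let $M$ be a $\mathbb{Z}G$-module which is $H$-acyclic for each finite subgroup $H$ of $G$; for example, this holds if $M = AG$ for an abelian group $A$, or if $M$ is $o(G)$-inverting. Then $\mathrm{H}^{n}(G,M) = 0$ for all $n \in \mathbb{N}$ with $n > \aleph\text{-rank}(G) + 1$.
   Context: A group is locally finite if each of its finitely generated subgroups is finite. Modules are left modules. $\aleph$-rank: let $\mathrm{rank}(G)$ be the smallest cardinality of a generating set of $G$. If $G$ is not finitely generated, then $\mathrm{rank}(G)=|G|$, and $\aleph\text{-rank}(G)$ is the ordinal $\alpha$ such that $\mathrm{rank}(G)=\aleph_\alpha$; if $G$ is finitely generated, $\aleph\text{-rank}(G) = -1$. For a group $H$, a $\mathbb{Z}H$-module $M$ is $H$-acyclic if $\mathrm{H}^n(H,M)=0$ for all $n\ge 1$; for a subgroup $H \le G$, a $\mathbb{Z}G$-module is regarded as a $\mathbb{Z}H$-module by restriction. For a $\mathbb{Z}$-module $A$ with trivial $G$-action, $AG$ denotes the induced $\mathbb{Z}G$-module $\mathbb{Z}G\otimes_{\mathbb{Z}}A$. A $\mathbb{Z}$-module (or $\mathbb{Z}G$-module) is $o(G)$-inverting if, for every finite subgroup $H$ of $G$, multiplication by $|H|$ is an automorphism of it as an abelian group. *)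

(* Defs.v *)
From HB Require Import structures.
From mathcomp Require Import all_boot all_order all_algebra.
From mathcomp Require Import boolp classical_sets functions cardinality wochoice.
From mathcomp Require Import freeg.

Set Implicit Arguments.
Unset Strict Implicit.
Unset Printing Implicit Defensive.

Import GRing.Theory.

Local Open Scope classical_set_scope.
Local Open Scope card_scope.
Local Open Scope ring_scope.

Definition is_subgroup (G : groupType) : set (set G) :=
  [set H | H 1%g /\ forall x y, H x -> H y -> H (x / y)%g].

Record subgroup (G : groupType) := Subgroup {
  subgroup_set :> set G;
  subgroupP : is_subgroup subgroup_set }.

Definition subgroup_type (G : groupType) (H : subgroup G) : Type :=
  set_type H.

Section SubgroupType.
Variables (G : groupType) (H : subgroup G).

HB.instance Definition _ := SubChoice.on (subgroup_type H).

Fact subgroup_group_closed : group_closed (fun x : G => x \in (H : set G)).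
Proof.
have [H1 Hdiv] := subgroupP H; split; first exact/mem_set.
by move=> x y /set_mem Hx /set_mem Hy; apply/mem_set/Hdiv.
Qed.

HB.instance Definition _ :=
  SubChoice_isSubGroup.Build G _ (subgroup_type H) subgroup_group_closed.

End SubgroupType.

Definition generated (G : groupType) (S : set G) : set G :=
  smallest (@is_subgroup G) S.

Definition finitely_generated (G : groupType) :=
  exists2 S : set G, finite_set S & generated S = setT.

Definition locally_finite (G : groupType) :=
  forall S : set G, finite_set S -> finite_set (generated S).

(* Left ZG-modules, given as abelian groups with an additive left G-action. *)

Record gmodule (G : groupType) := GModule {
  gmod_sort :> zmodType;
  gact : G -> gmod_sort -> gmod_sort;
  gact1 : forall m, gact 1%g m = m;
  gactM : forall g h m, gact (g * h)%g m = gact g (gact h m);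
  gactD : forall g m m', gact g (m + m') = gact g m + gact g m' }.

Arguments gact {G g0} : rename.

Section Restriction.
Variables (G : groupType) (M : gmodule G) (H : subgroup G).

Let ract (h : subgroup_type H) (m : M) := gact (val h) m.

Fact ract1 m : ract 1%g m = m.
Proof. by rewrite /ract gmulf1 gact1. Qed.

Fact ractM g h m : ract (g * h)%g m = ract g (ract h m).
Proof. by rewrite /ract gmulfM gactM. Qed.

Fact ractD g m m' : ract g (m + m') = ract g m + ract g m'.
Proof. exact: gactD. Qed.

Definition restriction : gmodule (subgroup_type H) :=
  GModule ract1 ractM ractD.

End Restriction.

(* Group cohomology, computed with the standard (homogeneous bar) resolution:
   the n-cochains are the G-equivariant maps G^(n+1) -> M. *)

Section Cohomology.
Variables (G : groupType) (M : gmodule G).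

Definition cochains (n : nat) : set (('I_n.+1 -> G) -> M) :=
  [set f | forall g x, f (fun i => (g * x i)%g) = gact g (f x)].
Arguments cochains : clear implicits.

Definition differential (n : nat) (f : ('I_n.+1 -> G) -> M) :
    ('I_n.+2 -> G) -> M :=
  fun x => \sum_(i < n.+2) f (fun j => x (fintype.lift i j)) *~ (-1) ^+ i.

Definition cocycles (n : nat) : set (('I_n.+1 -> G) -> M) :=
  cochains n `&` [set f | forall x, differential f x = 0].
Arguments cocycles : clear implicits.

Definition coboundaries (n : nat) : set (('I_n.+1 -> G) -> M) :=
  match n with
  | 0 => [set fun=> 0]
  | k.+1 => @differential k @` cochains k
  end.
Arguments coboundaries : clear implicits.

(* H^n(G, M) = 0 *)
Definition cohomology_vanishes (n : nat) :=
  cocycles n `<=` coboundaries n.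

Definition acyclic := forall n, (1 <= n)%N -> cohomology_vanishes n.

End Cohomology.

Arguments cochains {G} M n f.
Arguments cocycles {G} M n f.
Arguments coboundaries {G} M n f.

Definition finite_acyclic (G : groupType) (M : gmodule G) :=
  forall H : subgroup G, finite_set H -> acyclic (restriction M H).

Definition o_inverting (G : groupType) (M : gmodule G) :=
  forall (H : subgroup G) (n : nat), H #= `I_n ->
    bijective (fun m : M => m *+ n).

Definition biadditive (U V W : zmodType) (b : U -> V -> W) :=
  (forall v, zmod_morphism (b^~ v)) /\ (forall u, zmod_morphism (b u)).

Definition is_tensor_product (U V T : zmodType) (t : U -> V -> T) :=
  biadditive t /\
  forall (W : zmodType) (b : U -> V -> W), biadditive b ->
    exists! f : T -> W, zmod_morphism f /\ forall u v, f (t u v) = b u v.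

(* M = AG, the tensor product over Z of ZG and A.  The abelian group
   underlying ZG is {freeg G}, in which <<x>> is the element x of G; the
   action is determined by its values on the tensors of <<x>> and a. *)
Definition is_induced (G : groupType) (A : zmodType) (M : gmodule G) :=
  exists t : {freeg G} -> A -> M, is_tensor_product t /\
    forall (g x : G) (a : A), gact g (t << x >> a) = t << (g * x)%g >> a.

(* An ordinal is represented by a well-ordered type. *)

Record Ord := MkOrd {
  ord_sort :> Type;
  ord_le : rel ord_sort;
  ord_wo : well_order ord_le }.

Definition ord_slt (a : Ord) (x y : a) := ~~ ord_le y x.

Definition nat_ord (n : nat) : Ord.
Proof.
exists 'I_n (fun i j => (i <= j)%N) => A [i0 Ai0].
case: (arg_minnP (fun i : 'I_n => i : nat) Ai0) => i Ai min_i.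
exists i; split; first by split=> // j /min_i.
move=> j [Aj /(_ i Ai) le_ji]; apply/val_inj/anti_leq.
by rewrite le_ji min_i.
Defined.

Definition succ_le (a : Ord) : rel (option a) := fun x y =>
  match x, y with
  | Some u, Some v => ord_le u v
  | _, None => true
  | None, Some _ => false
  end.

Definition succ_ord (a : Ord) : Ord.
Proof.
exists (option a) (@succ_le a) => A [x0 Ax0].
have [[u Au]|noA] := pselect (exists u, Some u \in A).
  have [|m [[Am min_m] uniq_m]] := @ord_wo a [pred v | Some v \in A].
    by exists u.
  exists (Some m); split.
    by split=> // -[v|] //; apply: min_m.
  move=> [v|] [Av min_v]; last by have := min_v _ Am.
  congr Some; apply: uniq_m; split=> // w Aw.
  exact: (min_v (Some w)).
have A_None x : x \in A -> x = None.
  by case: x => // v Av; case: noA; exists v.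
exists None; split; last by move=> x [/A_None].
by split=> [|x /A_None->] //; rewrite -(A_None _ Ax0).
Defined.

(* a < b: a is isomorphic to a proper initial segment of b *)
Definition ord_lt (a b : Ord) :=
  exists (f : a -> b) (s : b),
    (forall x y, ord_le (f x) (f y) = ord_le x y) /\
    range f = [set y | ord_slt y s].

(* The cardinal of a set X of elements of T is compared with cardinals of
   sets of elements of T only, which realize all the cardinals up to that
   of X. *)

Definition card_slt (T : Type) (X Y : set T) := X #<= Y /\ ~~ (Y #<= X).

Definition least_infinite_above (T : Type) (F : set (set T)) (X : set T) :=
  [/\ infinite_set X, (forall Y, F Y -> card_slt Y X) &
      forall Z : set T, infinite_set Z -> (forall Y, F Y -> card_slt Y Z) ->
        X #<= Z].

(* #|X| = aleph_a, where aleph_a is the least infinite cardinal greater than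
   aleph_b for all b < a; the witness s is the sequence (aleph_b)_(b < a). *)
Definition is_aleph (a : Ord) (T : Type) (X : set T) :=
  exists s : a -> set T,
    (forall x, least_infinite_above (s @` [set y | ord_slt y x]) (s x)) /\
    least_infinite_above (range s) X.

(* The values of the aleph-rank: -1, or an ordinal. *)
Inductive aleph_index := MinusOne | Aleph of Ord.

Definition aleph_index_succ (r : aleph_index) : Ord :=
  match r with
  | MinusOne => nat_ord 0
  | Aleph a => succ_ord a
  end.

Definition generating_of_min_card (G : groupType) (S : set G) :=
  generated S = setT /\
  forall S' : set G, generated S' = setT -> S #<= S'.

Definition is_aleph_rank (G : groupType) (r : aleph_index) :=
  match r with
  | MinusOne => finitely_generated G
  | Aleph a => ~ finitely_generated G /\
      exists2 S : set G, generating_of_min_card S & is_aleph a S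
  end.

(* Main.v *)
Require Import Defs.
From HB Require Import structures.
From mathcomp Require Import all_boot all_order all_algebra.
From mathcomp Require Import boolp classical_sets functions cardinality.
From mathcomp Require Import wochoice freeg.

Set Implicit Arguments.
Unset Strict Implicit.
Unset Printing Implicit Defensive.

Import GRing.Theory.

Local Open Scope classical_set_scope.
Local Open Scope card_scope.
Local Open Scope ring_scope.

(** Everything is done on homogeneous cochains.

    Vanishing for G follows from vanishing for its subgroups by induction on
    the cardinal.  Let G be generated by an infinite set X of cardinal aleph_k.
    Order X so that every proper initial segment I is strictly smaller than X;
    the subgroups <I> form a chain with union G, and the induction hypothesis
    makes H^q(<I>, M) vanish for all q > k.  Given a cocycle f of degree
    n > k + 1, primitives of f on the <I> are built along this chain.  If u is
    one on <I> and w is the next element of X, pick any primitive u1 of f on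
    <I, w>; then u1 - u is a cocycle of degree n - 1 > k on <I>, hence the
    differential of some z, and u1 - dz is a primitive on <I, w> that agrees
    with u on <I>.  At limits primitives are glued, because a tuple of elements
    of the union lies in one member of the chain.  So each aleph costs one
    degree, and the induction starts with finite X, where local finiteness
    makes <X> finite and M acyclic.  This is vanishes_on_chain, iterated in
    vanishes_on_aleph_le.

    For cardinals, aleph_le k X encodes that X has cardinal at most aleph_k by
    the very recursion that the argument consumes: X is well-ordered with all
    initial segments of the previous level.  It is derived from the
    characterization of alephs as least infinite cardinals by means of an
    initial well-order (initial_well_order) and the comparability of cardinals
    (card_le_total).

    For the two families of examples, a finite group H acts acyclically as
    soon as the identity of M is the average sum_h h phi h^-1 of an additive
    endomorphism phi (averaging_acyclic).  If |H| is invertible on M, phi is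
    division by |H|.  If M = AG, phi projects onto the summands x (x) A for x
    in a transversal of the cosets Hx. *)

(** * Cochains *)

Fact gact_zmod_morphism (G : groupType) (M : gmodule G) (g : G) :
  zmod_morphism (gact g : M -> M).
Proof. by move=> x y; apply: (addIr (gact g y)); rewrite -gactD !subrK. Qed.

HB.instance Definition _ (G : groupType) (M : gmodule G) (g : G) :=
  GRing.isZmodMorphism.Build M M (gact g) (gact_zmod_morphism g).

Definition fcons (T : Type) (n : nat) (h : T) (x : 'I_n -> T) : 'I_n.+1 -> T :=
  fun i => if unlift ord0 i is Some j then x j else h.

Lemma fcons_lift0 (T : Type) n (h : T) (x : 'I_n -> T) :
  (fun j => fcons h x (fintype.lift ord0 j)) = x.
Proof. by apply/funext => j; rewrite /fcons liftK. Qed.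

Lemma fcons_lift (T : Type) n (h : T) (x : 'I_n.+1 -> T) (i : 'I_n.+1) :
  (fun j => fcons h x (fintype.lift (fintype.lift ord0 i) j)) =
  fcons h (fun j => x (fintype.lift i j)).
Proof.
apply/funext => j; case: (unliftP ord0 j) => [k|] ->.
  have -> : fintype.lift (fintype.lift ord0 i) (fintype.lift ord0 k) =
            fintype.lift ord0 (fintype.lift i k).
    by apply/val_inj; rewrite /= /bump /= !add1n ltnS addnS.
  by rewrite /fcons !liftK.
have -> : fintype.lift (fintype.lift ord0 i) ord0 = ord0 by exact/val_inj.
by rewrite /fcons !unlift_none.
Qed.

Lemma fcons_eta (T : Type) n (x : 'I_n.+1 -> T) :
  x = fcons (x ord0) (fun j => x (fintype.lift ord0 j)).
Proof.
apply/funext => j; rewrite /fcons.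
by case: (unliftP ord0 j) => [k|] ->.
Qed.

Section Differential.
Variables (G : groupType) (M : gmodule G).

(** Prepending h is a contracting homotopy of the complex of all functions, but
    not of the subcomplex of equivariant ones. *)
Lemma differential_cons n (f : ('I_n.+2 -> G) -> M) h (x : 'I_n.+2 -> G) :
  differential f (fcons h x) =
  f x - differential (fun y => f (fcons h y)) x.
Proof.
rewrite /differential big_ord_recl fcons_lift0 -sumrN; congr (_ + _).
apply: eq_bigr => i _; rewrite fcons_lift /= /bump /= add1n.
by rewrite exprS mulN1r mulrNz.
Qed.

Lemma differentialB n (f g : ('I_n.+1 -> G) -> M) x :
  differential (fun y => f y - g y) x = differential f x - differential g x.
Proof.
by rewrite /differential -sumrB; apply: eq_bigr => i _; rewrite mulrzBl.
Qed.

Lemma differential_cochain n (f : ('I_n.+1 -> G) -> M) :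
  cochains M n f -> cochains M n.+1 (differential f).
Proof.
move=> fG g x; rewrite /differential raddf_sum; apply: eq_bigr => i _.
by rewrite raddfMz /= -fG.
Qed.

(** By the homotopy formula ddf takes at (h, x) the value at x of ddf', where
    f' y = f (h, y) has one variable fewer; this descends to degree 0 and
    avoids the cancellation of double sums. *)
Lemma differential_differential n (f : ('I_n.+1 -> G) -> M) x :
  differential (differential f) x = 0.
Proof.
elim: n => [|n IHn] in f x *.
  rewrite [x]fcons_eta differential_cons.
  move: (x ord0) (fun j => _) => h {}x.
  have -> : (fun y => differential f (fcons h y)) =
      fun y => f y - f (fun=> h).
    apply/funext => y; rewrite /differential !big_ord_recl big_ord0 addr0.
    rewrite fcons_lift0 /= expr0 expr1 mulr1z mulrN1z; congr (f y - f _).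
    apply/funext => j; rewrite [j]ord1.
    have -> : fintype.lift (fintype.lift ord0 ord0) ord0 = ord0 :> 'I_2.
      exact/val_inj.
    by rewrite /fcons unlift_none.
  rewrite (differentialB f) opprB addrC subrK.
  by rewrite /differential !big_ord_recl big_ord0 addr0 /= mulr1z mulrN1z subrr.
rewrite [x]fcons_eta differential_cons.
move: (x ord0) (fun j => _) => h {}x.
have -> : (fun y => differential f (fcons h y)) =
    fun y => f y - differential (fun z => f (fcons h z)) y.
  by apply/funext => y; rewrite differential_cons.
by rewrite differentialB IHn subr0 subrr.
Qed.

Lemma cochainsB n (f g : ('I_n.+1 -> G) -> M) :
  cochains M n f -> cochains M n g -> cochains M n (fun y => f y - g y).
Proof. by move=> fG gG h x; rewrite fG gG raddfB. Qed.

End Differential.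

(** * Cohomology of a subgroup *)

(** The tuples contained in a coset gK, when K is a subgroup.  This form is
    invariant under G and makes sense for every set K. *)
Definition in_coset (G : groupType) (K : set G) (n : nat) (x : 'I_n -> G) :=
  forall i j, K ((x i)^-1 * x j)%g.

(** H^(p+1)(K, M) = 0 for a subgroup K, expressed with cochains of G.  A cochain
    of K extends to a cochain of G, which is determined on the tuples of
    in_coset K; cochains of different subgroups thus live in one type, and
    restriction from one to another is the identity. *)
Definition vanishes_on (G : groupType) (M : gmodule G) (K : set G) (p : nat) :=
  forall f, cochains M p.+1 f ->
    (forall x, in_coset K x -> differential f x = 0) ->
    exists2 u, cochains M p u &
      forall x, in_coset K x -> differential u x = f x.

Section Subgroups.
Variables (G : groupType).
Implicit Types (K S : set G) (x y g : G).

Lemma subgroupV K x : is_subgroup K -> K x -> K x^-1%g.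
Proof. by move=> [K1 Kdiv] Kx; rewrite -[x^-1%g]mul1g; apply: Kdiv. Qed.

Lemma subgroupM K x y : is_subgroup K -> K x -> K y -> K (x * y)%g.
Proof.
move=> KG Kx Ky; rewrite -[y]invgK; apply: (proj2 KG) => //.
exact: subgroupV.
Qed.

Lemma generated_subgroup S : is_subgroup (generated S).
Proof.
split=> [K [[]]//|x y Sx Sy K KS].
by case: (KS) => -[_ Kdiv] _; apply: Kdiv; [apply: Sx|apply: Sy].
Qed.

Lemma generated_mono S S' : S `<=` S' -> generated S `<=` generated S'.
Proof. exact: sub_smallest2r (generated_subgroup S'). Qed.

Lemma generated_directed (I : Type) (A : set I) (D : I -> set G) :
  A !=set0 ->
  (forall p q, A p -> A q -> D p `<=` D q \/ D q `<=` D p) ->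
  generated (\bigcup_(p in A) D p) `<=` \bigcup_(p in A) generated (D p).
Proof.
move=> [p0 Ap0] tot; apply: smallest_sub; last first.
  by move=> x [p Ap Dx]; exists p => //; apply: sub_gen_smallest.
split=> [|x y [p Ap px] [q Aq qy]].
  by exists p0 => //; case: (generated_subgroup (D p0)).
have [sub|sub] := tot _ _ Ap Aq.
  exists q => //; apply: (proj2 (generated_subgroup _)) => //.
  exact: generated_mono px.
exists p => //; apply: (proj2 (generated_subgroup _)) => //.
exact: generated_mono qy.
Qed.

Lemma in_coset_bigcup (I : Type) (A : set I) (D : I -> set G) n
    (x : 'I_n -> G) :
  A !=set0 ->
  (forall p q, A p -> A q -> D p `<=` D q \/ D q `<=` D p) ->
  in_coset (\bigcup_(p in A) D p) x -> exists2 p, A p & in_coset (D p) x.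
Proof.
move=> A0 tot xD.
suff [p Ap sub] : exists2 p, A p & forall ij, ij \in enum {: 'I_n * 'I_n} ->
    D p ((x ij.1)^-1 * x ij.2)%g.
  by exists p => // i j; apply: (sub (i, j)); rewrite mem_enum.
elim: (enum _) => [|[i j] s [p Ap IHs]]; first by case: A0 => p; exists p.
have [q Aq qij] := xD i j.
have [sub|sub] := tot _ _ Ap Aq.
  by exists q => // ij; rewrite inE => /predU1P[->//|/IHs/sub].
by exists p => // ij; rewrite inE => /predU1P[->/=|/IHs//]; apply: sub.
Qed.

Lemma in_coset_mul K n (x : 'I_n -> G) g :
  in_coset K (fun i => g * x i)%g = in_coset K x.
Proof.
by apply/propext; split=> Kx i j; have := Kx i j; rewrite invgM -mulgA mulKg.
Qed.

Lemma in_coset_sub K K' n (x : 'I_n -> G) :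
  K `<=` K' -> in_coset K x -> in_coset K' x.
Proof. by move=> KK' Kx i j; apply/KK'. Qed.

Lemma in_coset_face K n (x : 'I_n.+1 -> G) i :
  in_coset K x -> in_coset K (fun j => x (fintype.lift i j)).
Proof. by move=> Kx j k; apply: Kx. Qed.

End Subgroups.

Section VanishesOn.
Variables (G : groupType) (M : gmodule G).

Lemma eq_differential_on (K : set G) n (f g : ('I_n.+1 -> G) -> M) x :
  (forall y, in_coset K y -> f y = g y) -> in_coset K x ->
  differential f x = differential g x.
Proof.
by move=> fg Kx; apply: eq_bigr => i _; rewrite fg //; apply: in_coset_face.
Qed.

(** A cochain u0 of H extends to G by x |-> x_0 u0(x_0^-1 x) on the tuples
    contained in a coset gH, and by zero elsewhere. *)
Lemma vanishes_on_restriction (H : subgroup G) p :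
  cohomology_vanishes (restriction M H) p.+1 -> vanishes_on M H p.
Proof.
move=> vanH f fG df0.
have HG := subgroupP H.
pose f0 (y : 'I_p.+2 -> subgroup_type H) : restriction M H :=
  f (fun i => val (y i)).
have in_cosetH n (y : 'I_n -> subgroup_type H) :
    in_coset H (fun i => val (y i)).
  move=> i j; apply: subgroupM => //; last exact: set_valP.
  by apply: subgroupV => //; exact: set_valP.
have [|u0 u0H du0] := vanH f0.
  split=> [h y|y]; last exact: df0 (in_cosetH _ y).
  rewrite /f0 /= -fG; congr f; apply/funext => i; exact: gmulfM.
pose toH : G -> subgroup_type H := insubd (1%g : subgroup_type H).
have toHK g : (H : set G) g -> val (toH g) = g.
  by move=> Hg; rewrite /toH insubdK // inE.
have valK h : toH (val h) = h by exact: valKd.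
pose u x : M := if `[< in_coset H x >] then
    gact (x ord0) (u0 (fun i => toH ((x ord0)^-1 * x i)%g)) else 0.
have uG : cochains M p u.
  move=> g x; rewrite /u in_coset_mul; case: ifP => _; last by rewrite raddf0.
  rewrite gactM; congr (gact _ (gact _ _)); congr u0; apply/funext => i.
  by rewrite invgM -mulgA mulKg.
exists u => // x Hx.
pose y i := toH ((x ord0)^-1 * x i)%g.
have -> : x = fun i => (x ord0 * val (y i))%g.
  by apply/funext => i; rewrite toHK // mulVKg.
rewrite (differential_cochain uG) fG; congr gact.
have -> : f (fun i => val (y i)) = f0 y by [].
rewrite -du0; apply: eq_bigr => i _; congr (_ *~ _).
rewrite /u asboolT //.
set z := fun j => y (fintype.lift i j).
have -> : (fun j => toH ((val (z ord0))^-1 * val (z j))%g) =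
          (fun j => (z ord0)^-1 * z j)%g.
  by apply/funext => j; rewrite -[RHS]valK; congr toH; rewrite gmulfM gmulfV.
by rewrite u0H /= -gactM divgg gact1.
Qed.

Lemma vanishes_on_setT p :
  vanishes_on M setT p -> cohomology_vanishes M p.+1.
Proof.
move=> van f [fG df0]; have [|u uG du] := van f fG; first by move=> x _.
by exists u => //; apply/funext => x; apply: du => i j.
Qed.

End VanishesOn.

(** * Passing to the union of a chain *)

(** Minima in the strict sense, applied to pairs, give totality. *)
Definition strict_wo (T : Type) (X : set T) (lt : T -> T -> Prop) :=
  (forall v w, X v -> X w -> lt v w -> ~ lt w v) /\
  forall A : set T, A `<=` X -> A !=set0 ->
    exists2 w, A w & forall v, A v -> v <> w -> lt w v.

Definition segment (T : Type) (X : set T) (lt : T -> T -> Prop) (w : T) :=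
  [set v | X v /\ lt v w].

Section Chain.
Variables (G : groupType) (M : gmodule G) (X : set G) (lt : G -> G -> Prop).
Variable p : nat.
Hypothesis ltX : strict_wo X lt.
Variable f : ('I_p.+3 -> G) -> M.
Hypothesis fG : cochains M p.+2 f.
Hypothesis df0 : forall x, in_coset (generated X) x -> differential f x = 0.

Let partial_primitive (Iu : set G * (('I_p.+2 -> G) -> M)) :=
  [/\ Iu.1 `<=` X,
      forall v w, X v -> Iu.1 w -> lt v w -> Iu.1 v,
      cochains M p.+1 Iu.2 &
      forall x, in_coset (generated Iu.1) x -> differential Iu.2 x = f x].

Let extends (P Q : {Iu | partial_primitive Iu}) : bool :=
  `[< (sval P).1 `<=` (sval Q).1 /\
      forall x, in_coset (generated (sval P).1) x ->
        (sval Q).2 x = (sval P).2 x >].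

(** The value at x is that of any member of A whose group has x in one of its
    cosets; outside the cosets of the union, where no member constrains it, it
    is 0. *)
Lemma partial_primitive_union (A : set {Iu | partial_primitive Iu}) :
  A !=set0 -> total_on A extends -> exists Q, forall P, A P -> extends P Q.
Proof.
move=> A0 Atot.
pose D (P : {Iu | partial_primitive Iu}) := (sval P).1.
have Dtot P Q : A P -> A Q -> D P `<=` D Q \/ D Q `<=` D P.
  by move=> AP AQ; have [/asboolP[]|/asboolP[]] := Atot _ _ AP AQ; [left|right].
have gDtot P Q : A P -> A Q -> generated (D P) `<=` generated (D Q) \/
    generated (D Q) `<=` generated (D P).
  by move=> AP AQ; have [/generated_mono|/generated_mono] := Dtot _ _ AP AQ;
    [left|right].
pose I := \bigcup_(P in A) D P.
pose val_at x := [set m | exists P, [/\ A P, in_coset (generated (D P)) x &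
  m = (sval P).2 x]].
pose u x : M := xget 0 (val_at x).
have uE P x : A P -> in_coset (generated (D P)) x -> u x = (sval P).2 x.
  move=> AP Px; apply: xget_unique; first by exists P.
  move=> m [Q [AQ Qx ->]].
  by have [/asboolP[_ ->]|/asboolP[_ ->]] := Atot _ _ AP AQ.
have uN x : (forall P, A P -> ~ in_coset (generated (D P)) x) -> u x = 0.
  by move=> noP; apply: xgetPN => m [P [AP Px _]]; apply: (noP P).
have Ico n (x : 'I_n -> G) : in_coset (generated I) x ->
    exists2 P, A P & in_coset (generated (D P)) x.
  move=> Ix; apply: in_coset_bigcup => //.
  exact: in_coset_sub (generated_directed A0 Dtot) Ix.
have Iu : partial_primitive (I, u).
  split=> /= [w [P _ Pw]|v w Xv [P AP Pw] vw|g x|x /Ico[P AP Px]].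
  - by case: (svalP P) => + _ _ _; apply.
  - by exists P => //; case: (svalP P) => _ down _ _; apply: down Pw vw.
  - have [[P AP Px]|noP] := pselect (exists2 P, A P &
      in_coset (generated (D P)) x).
      rewrite !(uE P) ?in_coset_mul //.
      by case: (svalP P) => _ _ + _; apply.
    rewrite !uN ?raddf0 // => P AP; rewrite ?in_coset_mul => Px;
      by apply: noP; exists P.
  - rewrite (eq_differential_on (g := (sval P).2) _ Px); last first.
      by move=> y Py; apply: uE.
    by case: (svalP P) => _ _ _; apply.
exists (exist _ _ Iu) => P AP; apply/asboolP; split=> /= [w Pw|x Px].
  by exists P.
exact: uE.
Qed.

(** Any primitive on the larger group can be corrected, by the differential of
    a cochain z, so as to agree with u: their difference on <I> is a cocycle
    of degree one less, where the cohomology vanishes as well. *)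
Lemma partial_primitive_extend (I : set G) u w :
  partial_primitive (I, u) -> I = segment X lt w -> X w ->
  vanishes_on M (generated I) p ->
  vanishes_on M (generated (w |` I)) p.+1 ->
  exists2 u', partial_primitive (w |` I, u') &
    forall x, in_coset (generated I) x -> u' x = u x.
Proof.
move=> [/= IX Idown uG du] IE Xw van_p van_p1.
have wIX : w |` I `<=` X by move=> v [->|/IX].
have [|u1 u1G du1] := van_p1 f fG.
  by move=> x wIx; apply: df0; apply: in_coset_sub wIx; apply: generated_mono.
have [|x Ix|z zG dz] := van_p (fun y => u1 y - u y).
- exact: cochainsB.
- rewrite differentialB du // du1 ?subrr //.
  by apply: in_coset_sub Ix; apply: generated_mono; right.
exists (fun y => u1 y - differential z y); last first.
  by move=> x Ix; rewrite dz // subKr.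
split=> //= [v v' Xv [->|Iv'] vv'||x wIx].
- by right; rewrite IE.
- by right; apply: Idown vv'.
- by apply: cochainsB => //; apply: differential_cochain.
- by rewrite differentialB differential_differential subr0 du1.
Qed.

Lemma primitive_on_chain :
  vanishes_on M (generated set0) p.+1 ->
  (forall w, X w -> vanishes_on M (generated (segment X lt w)) p /\
     vanishes_on M (generated (w |` segment X lt w)) p.+1) ->
  exists2 u, cochains M p.+1 u &
    forall x, in_coset (generated X) x -> differential u x = f x.
Proof.
move=> van0 van; have [ltA wo] := ltX.
have [|u0 u0G du0] := van0 f fG.
  by move=> x x0; apply: df0; apply: in_coset_sub x0; apply: generated_mono.
have P0 : partial_primitive (set0, u0) by split.
(* Zorn's lemma takes the place of a transfinite recursion along X. *)
have [|P Q R /asboolP[PQ uPQ] /asboolP[QR uQR]|A Atot|P maxP] :=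
  @ZL_preorder _ (exist _ _ P0) extends.
- by move=> P; apply/asboolP; split.
- apply/asboolP; split=> [|x Px]; first exact: subset_trans QR.
  by rewrite uQR ?uPQ //; apply: in_coset_sub Px; apply: generated_mono.
- have [A0|noA] := pselect (A !=set0); first exact: partial_primitive_union.
  by exists (exist _ _ P0) => P AP; case: noA; exists P.
case: P maxP => -[I u] PIu maxP; have [/= IX Idown uG du] := PIu.
have [IXeq|nXI] := pselect (X `<=` I).
  by exists u => // x Xx; apply: du; apply: in_coset_sub Xx; apply: generated_mono.
have [||w [Xw nIw] w_min] := wo [set v | X v /\ ~ I v].
- by move=> v [].
- by apply: contra_notP nXI => no v Xv; apply: contra_notP no => nIv; exists v.
(* As I is an initial segment, it is exactly what precedes the least element
   w of its complement. *)
have IE : I = segment X lt w.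
  apply/seteqP; split=> [v Iv|v [Xv vw]].
    split; first exact: IX.
    have vNw : v <> w by move=> vw; apply: nIw; rewrite -vw.
    have [||m [->|->] m_min] := wo [set v; w].
    - by move=> _ [->|->] //; apply: IX.
    - by exists v; left.
    - by apply: m_min; [right|move/esym].
    - by case: nIw; apply: (Idown w v) => //; apply: m_min; [left|].
  apply: contrapT => nIv; have [vEw|vNw] := pselect (v = w).
    by apply: (ltA v w) => //; rewrite vEw in vw *.
  exact: (ltA v w) (w_min v _ vNw).
have [u' PIu' u'u] := partial_primitive_extend PIu IE Xw
  (eq_ind_r (fun J => vanishes_on M (generated J) p) (proj1 (van w Xw)) IE)
  (eq_ind_r (fun J => vanishes_on M (generated (w |` J)) p.+1)
    (proj2 (van w Xw)) IE).
have /asboolP[sub _] : extends (exist _ _ PIu') (exist _ _ PIu).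
  apply: maxP; apply/asboolP; split => //=; exact: subsetUr.
by case: nIw; apply: sub; left.
Qed.

End Chain.

(** Passing to the union of a chain costs one degree.  Every initial segment of
    X is the union of the closed segments below its elements, so limit steps
    need no hypothesis of their own. *)
Lemma vanishes_on_chain (G : groupType) (M : gmodule G) (X : set G) lt p :
  strict_wo X lt ->
  vanishes_on M (generated set0) p.+1 ->
  (forall w, X w -> vanishes_on M (generated (segment X lt w)) p /\
     vanishes_on M (generated (w |` segment X lt w)) p.+1) ->
  vanishes_on M (generated X) p.+1.
Proof. by move=> ltX van0 van f fG df0; apply: primitive_on_chain van. Qed.

(** * Cardinals *)

Lemma card_le_injP (T : Type) (X Y : set T) :
  X #<= Y <-> exists2 f : T -> T, set_fun X Y f & set_inj X f.
Proof.
elim/Ppointed: T => T in X Y *.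
  by rewrite (empty_eq0 X); split=> // _; exists id => ? // ? /set_mem.
by split=> [/pcard_leP/injfunPex|/injfunPex/pcard_leP].
Qed.

(** A maximal partial matching between X and Y exhausts one of the two sets. *)
Lemma card_le_total (T : Type) (X Y : set T) : X #<= Y \/ Y #<= X.
Proof.
pose matching (F : set (T * T)) := F `<=` X `*` Y /\
  forall p q, F p -> F q -> p.1 = q.1 <-> p.2 = q.2.
have [F Fm Ftot|F [[FXY Finj] Fmax]] := @Zorn_bigcup _ matching.
  split=> [p [A FA Ap]|p q [A FA Ap] [B FB Bq]].
    by case: (Fm _ FA) => + _; apply.
  have [AB|BA] := Ftot _ _ FA FB.
    by apply: (proj2 (Fm _ FB)) => //; apply: AB.
  by apply: (proj2 (Fm _ FA)) => //; apply: BA.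
have F1 : fst @` F #= F.
  apply: inj_card_eq => -[a b] [a' b'] /set_mem Fp /set_mem Fq /= aa'.
  by congr (_, _) => //; apply: (proj1 (Finj _ _ Fp Fq)).
have F2 : snd @` F #= F.
  apply: inj_card_eq => -[a b] [a' b'] /set_mem Fp /set_mem Fq /= bb'.
  by congr (_, _) => //; apply: (proj2 (Finj _ _ Fp Fq)).
have F12 : fst @` F #= snd @` F by rewrite (card_eql F1) card_eq_sym.
have [XF|nXF] := pselect (X `<=` fst @` F).
  left; apply: card_le_trans (subset_card_le XF) _.
  rewrite (card_le_eql F12); apply: subset_card_le.
  by move=> _ [p /FXY[_ ?] <-].
have [YF|nYF] := pselect (Y `<=` snd @` F).
  right; apply: card_le_trans (subset_card_le YF) _.
  rewrite -(card_le_eql F12); apply: subset_card_le.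
  by move=> _ [p /FXY[? _] <-].
have [x [Xx nFx]] : exists x, X x /\ ~ (fst @` F) x.
  by apply: contra_notP nXF => no x Xx; apply: contra_notP no => ?; exists x.
have [y [Yy nFy]] : exists y, Y y /\ ~ (snd @` F) y.
  by apply: contra_notP nYF => no y Yy; apply: contra_notP no => ?; exists y.
case: (Fmax ((x, y) |` F)).
  split; first by move=> p; right.
  by move=> sub; apply: nFx; exists (x, y) => //; apply: sub; left.
split=> [p [->|/FXY]//|p q [->|Fp] [->|Fq]] //=; last exact: Finj.
- by split=> [xq|yq]; [case: nFx|case: nFy]; exists q.
- by split=> [xp|yp]; [case: nFx|case: nFy]; exists p.
Qed.

Lemma card_le_setU1 (T : Type) (X : set T) (w : T) :
  infinite_set X -> w |` X #<= X.
Proof.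
elim/Ppointed: T => T in X w *.
  by move=> /infinite_setN0; rewrite (empty_eq0 X) => -[].
move=> /infiniteP/pcard_leP/injfunPex[e eX e_inj].
have {}e_inj m n : e m = e n -> m = n by apply: e_inj; rewrite inE.
have [Xw|nXw] := pselect (X w); first by apply: subset_card_le => v [->|].
(* The sequence e in X is shifted by one place, which frees e 0 for w. *)
pose shift v := if pselect (exists n, v = e n) is left vE
  then e (xget 0%N [set n | v = e n]).+1 else v.
have shift_e n : shift (e n) = e n.+1.
  rewrite /shift; case: pselect => [_|]; last by case; exists n.
  by congr (e _.+1); apply: xget_unique => // m /e_inj.
have shiftN v : (forall n, v <> e n) -> shift v = v.
  by move=> vN; rewrite /shift; case: pselect => // -[n /vN].
pose h v := if pselect (v = w) then e 0%N else shift v.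
have hw : h w = e 0%N by rewrite /h; case: pselect.
have hX v : X v -> h v = shift v.
  by move=> Xv; rewrite /h; case: pselect => // vw; case: nXw; rewrite -vw.
have shiftP v : (exists2 n, v = e n & shift v = e n.+1) \/
    (forall n, v <> e n) /\ shift v = v.
  have [[n ->]|noN] := pselect (exists n, v = e n); first by left; exists n.
  have vN n : v <> e n by move=> vn; apply: noN; exists n.
  by right; split=> //; apply: shiftN.
apply/card_le_injP; exists h => [v [->|Xv]|u v /set_mem uX /set_mem vX].
- by rewrite hw; apply: eX.
- by rewrite hX //; case: (shiftP v) => [[n _ ->]|[_ ->//]]; apply: eX.
case: uX vX => [->|Xu] [->|Xv] //; rewrite ?hw ?hX //.
- by case: (shiftP v) => [[n _ -> /e_inj]|[vN ->] /esym/vN].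
- by case: (shiftP u) => [[n _ -> /e_inj]|[uN ->] /uN].
case: (shiftP u) (shiftP v) => [[n -> ->]|[uN ->]] [[m -> ->]|[vN ->]] //.
- by move=> /e_inj[->].
- by move=> /esym/vN.
- by move=> /uN.
Qed.

(** Start from any well-order.  If X is equipotent to one of its segments, let x
    be the least element with an injection f of X into the segment of x, and
    pull the order back along f: a segment for the new order embeds into the
    segment of some f w < x, which is too small to contain a copy of X. *)
Lemma initial_well_order (T : Type) (X : set T) :
  exists2 lt, strict_wo X lt & forall w, X w -> ~ (X #<= segment X lt w).
Proof.
elim/Peq: T X => T X; have [R woR] := well_ordering_principle T.
have Rtot v w : R v w \/ R w v.
  by apply/orP; apply: (@wo_chainW _ R predT (withinW woR)).
have Ranti v w : R v w -> R w v -> v = w.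
  move=> vw wv; apply: (@wo_chain_antisymmetric _ R predT (withinW woR)) => //.
  by rewrite vw.
pose lt0 (v w : T) : Prop := ~~ R w v.
have lt0A v w : lt0 v w -> ~ lt0 w v.
  by move=> /negP vw /negP wv; case: (Rtot v w).
have wo0 (A : set T) : A !=set0 ->
    exists2 w, A w & forall v, A v -> v <> w -> lt0 w v.
  move=> [a Aa]; have [|w [[/set_mem Aw w_min] _]] := woR (mem A).
    by exists a; apply/mem_set.
  exists w => // v Av vNw; apply/negP => Rvw; apply: vNw.
  by apply: Ranti => //; apply/w_min/mem_set.
have [good|] := pselect (forall w, X w -> ~ (X #<= segment X lt0 w)).
  by exists lt0 => //; split=> [v w _ _|A _]; [exact: lt0A|exact: wo0].
move=> bad; have [|x [Xx Xsmall] x_min] :=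
  wo0 [set w | X w /\ X #<= segment X lt0 w].
  by apply: contra_notP bad => no w Xw Xle; apply: no; exists w.
have [f fX f_inj] := proj1 (card_le_injP _ _) Xsmall.
exists (fun v w => lt0 (f v) (f w)).
  split=> [v w _ _|A AX [a Aa]]; first exact: lt0A.
  have [|_ [w Aw <-] w_min] := wo0 (f @` A); first by exists (f a), a.
  exists w => // v Av vNw; apply: w_min; first by exists v.
  by move=> fvw; apply: vNw; apply: f_inj => //; apply/mem_set/AX.
move=> w Xw Xle; have [Xfw fwx] := fX _ Xw.
have Xle' : X #<= segment X lt0 (f w).
  apply: card_le_trans Xle _; apply/card_le_injP; exists f.
    by move=> v [Xv vw]; split=> //; case: (fX _ Xv).
  by move=> u v /set_mem[Xu _] /set_mem[Xv _]; apply: f_inj; apply/mem_set.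
have [fwE|fwN] := pselect (f w = x).
  by apply: (lt0A (f w) x) => //; rewrite fwE in fwx *.
exact: (lt0A (f w) x) fwx (x_min _ (conj Xfw Xle') fwN).
Qed.

(** X has cardinal at most aleph_k: aleph_(k+1) is the least cardinal above
    aleph_k, so its smaller initial segments are those of the previous level.
    The closed segments are included because the chain of subgroups passes from
    the segment below w to the one that contains w. *)
Fixpoint aleph_le (T : Type) (k : nat) (X : set T) : Prop :=
  if k is k'.+1 then
    exists2 lt, strict_wo X lt & forall w, X w ->
      aleph_le k' (segment X lt w) /\ aleph_le k' (w |` segment X lt w)
  else finite_set X.

Lemma finite_aleph_le (T : Type) k (X : set T) : finite_set X -> aleph_le k X.
Proof.
elim: k X => //= k IHk X Xfin; have [lt ltX _] := initial_well_order X.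
have seg_fin w : finite_set (segment X lt w).
  by apply: sub_finite_set Xfin => v [].
exists lt => // w Xw; split; apply: IHk => //.
by rewrite finite_setU; split=> //; apply: finite_set1.
Qed.

Lemma aleph_leS (T : Type) k (X : set T) : aleph_le k X -> aleph_le k.+1 X.
Proof.
elim: k X => [|k IHk] X; first exact: finite_aleph_le.
move=> [lt ltX seg]; exists lt => // w Xw.
by have [? ?] := seg w Xw; split; apply: IHk.
Qed.

Lemma aleph_le_mono (T : Type) k l (X : set T) :
  (k <= l)%N -> aleph_le k X -> aleph_le l X.
Proof.
move=> /subnKC <-; elim: (l - k)%N => [|d IHd]; first by rewrite addn0.
by rewrite addnS => /IHd/aleph_leS.
Qed.

(** For an initial well-order of Z, a segment is not above X, so by minimality
    of X it is finite or bounded by some member of F. *)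
Lemma aleph_le_least_above (T : Type) k (F : set (set T)) (X Z : set T) :
  least_infinite_above F X ->
  (forall Y Z' : set T, F Y -> Z' #<= Y -> aleph_le k Z') ->
  Z #<= X -> aleph_le k.+1 Z.
Proof.
move=> [Xinf FX Xleast] levF ZX.
have [lt ltZ Zinit] := initial_well_order Z.
have seg_le w : Z w -> infinite_set (segment Z lt w) ->
    exists2 Y, F Y & segment Z lt w #<= Y.
  move=> Zw seg_inf; apply: contrapT => no; apply: (Zinit w Zw).
  apply: card_le_trans ZX _; apply: Xleast => // Y FY; split.
    by case: (card_le_total Y (segment Z lt w)) => // ?; case: no; exists Y.
  by apply/negP => ?; case: no; exists Y.
exists lt => // w Zw.
have [seg_fin|seg_inf] := pselect (finite_set (segment Z lt w)).
  split; apply: finite_aleph_le => //.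
  by rewrite finite_setU; split=> //; apply: finite_set1.
have [Y FY segY] := seg_le w Zw seg_inf.
split; apply: (levF Y) => //.
exact: card_le_trans (card_le_setU1 w seg_inf) segY.
Qed.

(** The image of the top element of a + 1 bounds the ranks of the elements of
    a; it is below n - 1 since it lies in a proper initial segment. *)
Lemma ord_lt_succ_nat (a : Ord) n : ord_lt (succ_ord a) (nat_ord n) ->
  exists k, exists2 r : a -> nat, (k.+2 <= n)%N &
    (forall x, r x < k)%N /\ forall x y, ord_slt x y -> (r x < r y)%N.
Proof.
move=> [f [s [f_mono f_range]]].
have f_lt x y : ord_slt x y -> (nat_of_ord (f x) < nat_of_ord (f y))%N.
  by rewrite /ord_slt -f_mono /= ltnNge.
exists (nat_of_ord (f None)), (fun x => nat_of_ord (f (Some x))).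
  have : range f (f None) by exists None.
  rewrite f_range /= /ord_slt /= -ltnNge => fs.
  exact: leq_ltn_trans fs (ltn_ord s).
by split=> [x|x y xy]; apply: f_lt.
Qed.

Lemma is_aleph_le (a : Ord) (T : Type) (X : set T) (r : a -> nat) k :
  (forall x, r x < k)%N -> (forall x y, ord_slt x y -> (r x < r y)%N) ->
  is_aleph a X -> aleph_le k.+1 X.
Proof.
move=> rk r_mono [s [s_least X_least]].
have lev x (Z : set T) : Z #<= s x -> aleph_le (r x).+1 Z.
  have [d] := ubnP (r x); elim: d x Z => // d IHd x Z rxd Zs.
  apply: (aleph_le_least_above (s_least x) _ Zs).
  move=> Y Z' [y yx <-] Z'y; apply: aleph_le_mono (r_mono _ _ yx) _.
  by apply: IHd => //; apply: leq_trans (r_mono _ _ yx) _.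
apply: (aleph_le_least_above X_least _ (card_lexx X)) => Y Z' [x _ <-] Z'x.
exact: aleph_le_mono (rk x) (lev _ _ Z'x).
Qed.

(** * Acyclicity over finite groups *)

Section Finite.
Variables (G : groupType) (M : gmodule G).

Lemma fcons_mul n (g h : G) (x : 'I_n -> G) :
  fcons (g * h)%g (fun i => g * x i)%g = fun i => (g * fcons h x i)%g.
Proof. by apply/funext => i; rewrite /fcons; case: (unlift _ _). Qed.

(** Averaging the homotopy of differential_cons over the prepended element
    makes it equivariant.  The list e enumerates the group. *)
Lemma averaging_acyclic (e : seq G) (phi : {additive M -> M}) :
  uniq e -> (forall g, g \in e) ->
  (forall m, \sum_(h <- e) gact h (phi (gact h^-1%g m)) = m) ->
  acyclic M.
Proof.
move=> e_uniq e_all avg [|p] // _ f [fG df0].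
exists (fun x => \sum_(h <- e) gact h (phi (gact h^-1%g (f (fcons h x))))).
  move=> g x; rewrite raddf_sum /=.
  have e_perm : perm_eq e [seq (g * h)%g | h <- e].
    apply: uniq_perm => // [|h]; first by rewrite map_inj_uniq //; apply: mulgI.
    by rewrite e_all -[h](mulVKg g) map_f.
  rewrite (perm_big _ e_perm) big_map; apply: eq_bigr => h _.
  by rewrite fcons_mul fG -gactM invgM mulgVK gactM.
apply/funext => x; rewrite -[RHS]avg /differential.
under eq_bigr do rewrite mulrz_suml.
rewrite exchange_big; apply: eq_bigr => h _.
have -> : f x = differential (fun y => f (fcons h y)) x.
  by apply/eqP; rewrite -subr_eq0 -differential_cons df0.
by rewrite !raddf_sum; apply: eq_bigr => i _; rewrite !raddfMz.
Qed.

Lemma inverting_acyclic (e : seq G) :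
  uniq e -> (forall g, g \in e) ->
  bijective (fun m : M => m *+ size e) -> acyclic M.
Proof.
move=> e_uniq e_all [div mulK divK].
have divE x : div x *+ size e = x by exact: divK.
have div_add : zmod_morphism div.
  by move=> x y; apply: (can_inj mulK); rewrite /= mulrnBl !divE.
pose phi : {additive M -> M} :=
  HB.pack div (GRing.isZmodMorphism.Build M M div div_add).
apply: (@averaging_acyclic e phi) => //= m.
have divG (g : G) x : div (gact g x) = gact g (div x).
  by apply: (can_inj mulK); rewrite /= divE -raddfMn divE.
under eq_bigr do rewrite divG -gactM mulgV gact1.
by rewrite big_const_seq count_predT iter_addr_0 divE.
Qed.

End Finite.

Lemma subgroup_enum (G : groupType) (H : subgroup G) : finite_set H ->
  exists e : seq (subgroup_type H),
    [/\ uniq e, forall h, h \in e & H #= `I_(size e)].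
Proof.
move=> [n]; rewrite -(card_eql (card_setT H)) => Hn.
have Hfin : finite_set [set: subgroup_type H] by exists n.
exists (finmap.enum_fset (fset_set [set: subgroup_type H])).
split=> [|h|]; first exact: finmap.fset_uniq.
  by have := in_fset_set Hfin h; rewrite in_setT.
rewrite -(card_eql (card_setT H)) -[X in X #= _](fset_setK Hfin).
exact/card_eq_fsetP.
Qed.

Lemma o_inverting_finite_acyclic (G : groupType) (M : gmodule G) :
  o_inverting M -> finite_acyclic M.
Proof.
move=> inv H Hfin; have [e [e_uniq e_all He]] := subgroup_enum Hfin.
exact: (@inverting_acyclic _ (restriction M H) e) (inv _ _ He).
Qed.

Lemma freeg_additive_ext (K : choiceType) (V : zmodType)
    (f g : {additive {freeg K} -> V}) :
  (forall x, f << x >> = g << x >>) -> f =1 g.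
Proof.
move=> fg D; rewrite -(freeg_sumE D) !raddf_sum; apply: eq_bigr => z _.
by rewrite -[X in << X *g z >>]intz -freegU_mulz !raddfMz fg.
Qed.

Lemma induced_finite_acyclic (G : groupType) (A : zmodType) (M : gmodule G) :
  is_induced A M -> finite_acyclic M.
Proof.
move=> [t [[t_add t_univ] tG]] H Hfin.
have [e [e_uniq e_all _]] := subgroup_enum Hfin.
have HG := subgroupP H.
(* A representative of the coset Hx; the elements with rep x = x form the
   transversal. *)
pose rep (x : G) := xget 1%g [set y | (H : set G) (x / y)%g].
have repP x : (H : set G) (x / rep x)%g.
  rewrite /rep; case: xgetP => [y _ //|/(_ x)].
  by rewrite /= divgg; case: HG.
have repM (h : subgroup_type H) x : rep (val h * x)%g = rep x.
  rewrite /rep; congr xget; apply/seteqP; split=> y /= Hy.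
    rewrite -[x](mulKg (val h)) -mulgA; apply: subgroupM => //.
    by apply: subgroupV => //; apply: set_valP.
  by rewrite -mulgA; apply: subgroupM => //; apply: set_valP.
pose pi : {freeg G} -> {freeg G} :=
  fglift (fun x => if rep x == x then << x >> else 0).
have piB : zmod_morphism pi by exact: lift_is_additive.
have piU x : pi << x >> = if rep x == x then << x >> else 0.
  by rewrite /pi liftU scale1r.
have [tl tr] := t_add.
have [|psi [[psiB psi_t] _]] := t_univ M (fun u a => t (pi u) a).
  by split=> [a u v|u a b]; rewrite ?piB ?tl ?tr.
pose phi : {additive M -> M} :=
  HB.pack psi (GRing.isZmodMorphism.Build M M psi psiB).
have phi_t u a : phi (t u a) = t (pi u) a by exact: psi_t.
pose avg (m : M) : M :=
  \sum_(h <- e) gact (val h) (phi (gact (val h)^-1%g m)).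
have avgB : zmod_morphism avg.
  by move=> x y; rewrite /avg -sumrB; apply: eq_bigr => h _; rewrite !raddfB.
have avg_t u a : avg (t u a) = t u a.
  pose ta : {additive {freeg G} -> M} :=
    HB.pack (t^~ a) (GRing.isZmodMorphism.Build {freeg G} M (t^~ a) (tl a)).
  pose avg_add : {additive M -> M} :=
    HB.pack avg (GRing.isZmodMorphism.Build M M avg avgB).
  apply: (@freeg_additive_ext _ _ (avg_add \o ta) ta) => x /=.
  rewrite /avg.
  pose h0 : subgroup_type H := insubd 1%g (x / rep x)%g.
  have h0E : val h0 = (x / rep x)%g.
    by rewrite /h0 insubdK // inE; apply: repP.
  (* The cosets being free orbits, exactly one h moves x to the transversal. *)
  have term h : gact (val h) (phi (gact (val h)^-1%g (t << x >> a))) =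
      if h == h0 then t << x >> a else 0.
    rewrite tG phi_t piU -gmulfV repM.
    have -> : (rep x == val h^-1 * x)%g = (h == h0).
      apply/eqP/eqP => [repE|->].
        by apply/val_inj; rewrite h0E repE invgM gmulfV invgK mulVKg.
      by move: h0E; rewrite gmulfV /= => ->; rewrite invgM invgK mulgVK.
    case: ifP => _; first by rewrite tG gmulfV mulVKg.
    have -> : t 0 a = 0 by have := raddf0 ta.
    exact: raddf0.
  under eq_bigr do rewrite term.
  by rewrite (bigD1_seq h0) //= eqxx big1 ?addr0 // => h /negPf ->.
apply: (@averaging_acyclic _ (restriction M H) e phi) => // m.
(* Both the average and the identity extend t along the tensor product. *)
have [f [_ f_uniq]] := t_univ M t t_add.
have avgE : avg = id by rewrite -(f_uniq avg) // -(f_uniq id).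
rewrite -[RHS]/(id (m : M)) -avgE; apply: eq_bigr => h _.
by rewrite -gmulfV.
Qed.

(** * Vanishing above the aleph-rank *)

Lemma vanishes_on_aleph_le (G : groupType) (M : gmodule G) k p (X : set G) :
  locally_finite G -> finite_acyclic M ->
  aleph_le k X -> (k <= p)%N -> vanishes_on M (generated X) p.
Proof.
move=> Glf Mac.
have fin_case (Y : set G) q : finite_set Y -> vanishes_on M (generated Y) q.
  move=> Yfin; pose H := Subgroup (generated_subgroup Y).
  apply: (@vanishes_on_restriction _ _ H); apply: Mac => //.
  exact: Glf.
elim: k p X => [|k IHk] [|p] X //=; try by move=> Xfin _; apply: fin_case.
move=> [lt ltX seg] kp; apply: (vanishes_on_chain ltX).
  exact: fin_case.
move=> w /seg[seg_le wseg_le]; split; apply: IHk => //.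
exact: leqW.
Qed.

(** For a finite ordinal a, an ordinal embedding of a + 1 into n turns aleph_a
    into a level k + 1 of aleph_le with k + 2 <= n.  If G is finitely
    generated, its generators are of level 0. *)
Theorem theorem3p10 (G : groupType) (G_lf : locally_finite G) :
  (forall M : gmodule G, finite_acyclic M ->
     forall r : aleph_index, is_aleph_rank G r ->
     forall n : nat, ord_lt (aleph_index_succ r) (nat_ord n) ->
     cohomology_vanishes M n) /\
  (forall (A : zmodType) (M : gmodule G), is_induced A M ->
     finite_acyclic M) /\
  (forall M : gmodule G, o_inverting M -> finite_acyclic M).
Proof.
split; last by split=> [A|] M; [exact: induced_finite_acyclic|
  exact: o_inverting_finite_acyclic].
move=> M Mac [|a] /=.
  move=> [S Sfin ST] [[_ [[]]]//|p _].
  apply: vanishes_on_setT; rewrite -ST.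
  exact: (@vanishes_on_aleph_le _ _ 0).
move=> [_ [S [ST _] Sa]] n /ord_lt_succ_nat[k [r + [rk r_mono]]].
case: n => // p kp; apply: vanishes_on_setT; rewrite -ST.
exact: (vanishes_on_aleph_le G_lf Mac (is_aleph_le rk r_mono Sa)).
Qed.
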